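(* Let $\lambda_{\min},\lambda_{\max}$ with $0<\lambda_{\min}\le\lambda_{\max}<\infty$ and positive weights $\omega=\{\omega_i\}_{i=0}^n$ be such that $$\lambda_{\min}\,|||v|||_\omega^2\le a(v,v)\le\lambda_{\max}\,|||v|||_\omega^2\qquad\text{for all } v\in V,$$ and let $\underline{\lambda},\bar{\lambda}$ satisfy $0<\underline{\lambda}\le\lambda_{\min}\le\lambda_{\max}\le\bar{\lambda}$. Put $\bar\kappa:=\bar\lambda/\underline\lambda$. Let $\{p_m\}_{m\ge0}$ be a fixed sequence of integers with $1\le p_m\le n+1$. Set $\xi_m=\bar\lambda^{-1}$, $\eta_m=(\bar\lambda\underline\lambda)^{-1/2}$, and let $\alpha_m,\beta_m\in(0,1)$ be defined by $$\frac{1-\alpha_m}{\alpha_m}=\frac{(n+1)\bar\lambda}{p_m}\,\eta_m,\qquad \beta_m=1-\frac{p_m}{(n+1)\bar\kappa^{1/2}}.$$ Consider the iteration with $u^{(0)}=v^{(0)}=0$ and, for $m=0,1,\dots$, $$w^{(m)}=\alpha_mv^{(m)}+(1-\alpha_m)u^{(m)},$$ $$u^{(m+1)}=w^{(m)}+\xi_m\sum_{i\in I_m}\omega_iR_iT_ie_w^{(m)},$$ $$v^{(m+1)}=\beta_mv^{(m)}+(1-\beta_m)w^{(m)}+\eta_m\sum_{i\in I_m}\omega_iR_iT_ie_w^{(m)},$$ where $u\in V$ is the solution of $a(u,v)=F(v)$ for all $v\in V$, and $e_u^{(m)}:=u-u^{(m)}$, $e_v^{(m)}:=u-v^{(m)}$,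 $e_w^{(m)}:=u-w^{(m)}$. (i) If each $I_m$ is a random subset of $\{0,1,\dots,n\}$ of size $p_m$ satisfying assumption (A), then for $m=0,1,\dots$ $$\mathbb{E}\big(\|e_u^{(m+1)}\|^2+\underline\lambda\,|||e_v^{(m+1)}|||_\omega^2\,\big|\,u^{(m)},v^{(m)}\big)\le\left(1-\frac{p_m}{(n+1)\sqrt{\bar\kappa}}\right)\big(\|e_u^{(m)}\|^2+\underline\lambda\,|||e_v^{(m)}|||_\omega^2\big).$$ (ii) If in addition assumption (B) holds, then for any $u\in V$ the iteration converges in expectation (that is, $\mathbb{E}(\|e_u^{(m)}\|^2)\to0$ as $m\to\infty$), and $$\mathbb{E}\big(\|e_u^{(m)}\|^2\big)\le2\prod_{s=0}^{m-1}\left(1-\frac{p_s}{(n+1)\sqrt{\bar\kappa}}\right)\|u\|^2,\qquad m=1,2,\dots.$$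
   Context: Setting. $V$ is a separable real Hilbert space, $a(\cdot,\cdot)$ is a continuous, coercive, symmetric bilinear form on $V$, and $F$ is a bounded linear functional on $V$. $V$ is equipped with the scalar product $a(\cdot,\cdot)$ and norm $\|v\|=a(v,v)^{1/2}$. The solution $u\in V$ is the unique element with $a(u,v)=F(v)$ for all $v\in V$. Space splitting. $V_0,\dots,V_n$ are separable real Hilbert spaces, each equipped with a scalar product $a_i(\cdot,\cdot)$ spectrally equivalent to the original scalar product of $V_i$. $R_i:V_i\to V$ are bounded linear operators with $\mathrm{Ker}(R_i)=\{0\}$ and $\sum_{i=0}^nR_iV_i=V$. The bounded linear operators $T_i:V\to V_i$ are defined by $a_i(T_iv,v_i)=a(v,R_iv_i)$ for all $v_i\in V_i$, $v\in V$. Norm. For positive weights $\omega_i$, $$|||v|||_\omega^2:=\inf\Big\{\sum_{i=0}^n\omega_i a_i(v_i,v_i)\ :\ v_i\in V_i,\ v=\sum_{i=0}^n\omega_iR_iv_i\Big\}.$$ Assumption (A): $I_m$ is a uniformly at random chosen subset of size $p_m$ of $\{0,1,\dots,n\}$, i.e., $|I_m|=p_m$ and $\mathbb{P}(i\in I_m)=\mathbb{P}(i'\in I_m)$ for all $i,i'\in\{0,\dots,n\}$. Assumption (B): the choices of $I_m$ are independent for different $m$. Convention: $\mathbb{E}(\cdot\,|\,u^{(m)},v^{(m)})$ denotes the expectation with respect to the random choice of $I_m$, for arbitrarily fixed $u^{(m)},v^{(m)}$. *)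

(* Defs.v *)
From HB Require Import structures.
From mathcomp Require Import all_boot all_order all_algebra.
From mathcomp Require Import sesquilinear.
From mathcomp Require Import all_classical all_reals all_analysis.

Set Implicit Arguments.
Unset Strict Implicit.
Unset Printing Implicit Defensive.

Import Order.TTheory GRing.Theory Num.Theory.
Import numFieldNormedType.Exports.

Local Open Scope classical_set_scope.
Local Open Scope ring_scope.

(** Separable real Hilbert spaces and bounded maps *)

(* Completeness is carried by [completeNormedModType]; what remains is that
   the norm comes from a scalar product and that the space is separable. *)
Definition separable_hilbert (R : realType) (V : completeNormedModType R) :=
  (exists ip : {dot V for idfun}, forall v, ip v v = `|v| ^+ 2) /\
  (exists D : set V, countable D /\ dense D).

Definition bounded_op (R : realType) (V W : normedModType R) (f : V -> W) :=
  exists C : R, forall v, `|f v| <= C * `|v|.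

Definition bounded_functional (R : realType) (V : normedModType R)
    (f : V -> R) :=
  exists C : R, forall v, `|f v| <= C * `|v|.

Definition coercive (R : realType) (V : normedModType R)
    (a : V -> V -> R) :=
  exists2 c : R, 0 < c & forall v, c * `|v| ^+ 2 <= a v v.

(* In a Hilbert space, [`|v| ^+ 2] is the original scalar product of [v] with
   itself. *)
Definition spectrally_equivalent (R : realType) (V : normedModType R)
    (b : V -> V -> R) :=
  exists c C : R, [/\ 0 < c, 0 < C &
    forall v, c * `|v| ^+ 2 <= b v v /\ b v v <= C * `|v| ^+ 2].

Definition energy_norm (R : realType) (V : lmodType R) (a : V -> V -> R)
    (v : V) : R :=
  Num.sqrt (a v v).

(** Space splittings *)

(* The squared weighted norm |||v|||_w ^ 2. The infimum is that of a set of
   nonnegative reals, nonempty as soon as the [w i] are nonzero and the ranges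
   of the [R_ i] span [V]; otherwise [inf] may take a default value. *)
Definition split_norm2 (R : realType) (n : nat) (V : lmodType R)
    (V_ : 'I_n.+1 -> lmodType R) (a_ : forall i, V_ i -> V_ i -> R)
    (R_ : forall i, V_ i -> V) (w : 'I_n.+1 -> R) (v : V) : R :=
  inf [set s : R | exists v_ : forall i, V_ i,
    v = \sum_(i < n.+1) w i *: R_ i (v_ i) /\
    s = \sum_(i < n.+1) w i * a_ i (v_ i) (v_ i)].

Definition subset_correction (R : realType) (n : nat) (V : lmodType R)
    (V_ : 'I_n.+1 -> lmodType R) (R_ : forall i, V_ i -> V)
    (T_ : forall i, V -> V_ i) (w : 'I_n.+1 -> R)
    (S : {set 'I_n.+1}) (e : V) : V :=
  \sum_(i in S) w i *: R_ i (T_ i e).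

(** The accelerated iteration *)

(* A state is a pair (u^(m), v^(m)); [G S e] is the correction computed on the
   index set [S] from the error [e]. *)
Definition accel_step (R : realType) (n : nat) (V : lmodType R)
    (G : {set 'I_n.+1} -> V -> V) (u : V) (alpha beta xi eta : R)
    (S : {set 'I_n.+1}) (x : V * V) : V * V :=
  let w := alpha *: x.2 + (1 - alpha) *: x.1 in
  (w + xi *: G S (u - w),
   beta *: x.2 + (1 - beta) *: w + eta *: G S (u - w)).

Fixpoint accel_iter (R : realType) (n : nat) (V : lmodType R)
    (G : {set 'I_n.+1} -> V -> V) (u : V) (alpha beta xi eta : nat -> R)
    (S : nat -> {set 'I_n.+1}) (m : nat) : V * V :=
  if m is k.+1 then
    accel_step G u (alpha k) (beta k) (xi k) (eta k) (S k)
      (accel_iter G u alpha beta xi eta S k)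
  else (0, 0).

(** Random index sets *)

(* Uniformity only asks for equal inclusion probabilities of the indices, not
   for all subsets of size [k] to be equally likely. *)
Definition uniform_random_subset (d : measure_display) (Om : measurableType d)
    (R : realType) (P : probability Om R) (n k : nat)
    (J : Om -> {set 'I_n.+1}) :=
  [/\ forall S, measurable (J @^-1` [set S]),
      forall t, #|J t| = k &
      forall i i', P [set t | i \in J t] = P [set t | i' \in J t]].

(* Every subset of the (finite) range [K] counts as an event. *)
Definition mutually_independent (d : measure_display) (Om : measurableType d)
    (R : realType) (P : probability Om R) (K : finType) (J : nat -> Om -> K) :=
  forall (s : seq nat) (B : nat -> set K), uniq s ->
    P (\bigcap_(m in [set` s]) (J m @^-1` B m)) =
    (\prod_(m <- s) fine (P (J m @^-1` B m)))%:E.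

(* Main.v *)
(* The squared norm [|||v|||_w ^ 2] is the infimum of the costs of the
   decompositions of [v]. Correcting [b] by the local solutions [T_i e], i in S,
   modifies a near-optimal decomposition of [b] in the components i in S only, so
   the dual error after the step is bounded by the cost of the modified
   decomposition, without inverting the operator [sum_i w_i R_i T_i]. Averaging
   over S turns the cross term into (p_m / (n+1)) a(e, b), because
   [a_i(T_i e, b_i) = a(e, R_i b_i)]; the parameters are chosen so that the
   quadratic terms cancel and the remainder contracts by [beta_m]. Since the sets
   are independent, this one-step estimate iterates. *)
Require Import Defs.
From HB Require Import structures.
From mathcomp Require Import all_boot all_order all_algebra.
From mathcomp Require Import sesquilinear.
From mathcomp Require Import all_classical all_reals all_analysis.
From mathcomp Require Import ring lra.

Set Implicit Arguments.
Unset Strict Implicit.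
Unset Printing Implicit Defensive.

Import Order.TTheory GRing.Theory Num.Theory.
Import numFieldNormedType.Exports.

Local Open Scope classical_set_scope.
Local Open Scope ring_scope.

(** * Expectations of functions of a random variable with finite range *)

Section FiniteRange.
Context (d : measure_display) (Om : measurableType d) (R : realType).
Variables (P : probability Om R).

Definition pmass (K : finType) (J : Om -> K) (k : K) : R :=
  fine (P (J @^-1` [set k])).

Lemma pmass_ge0 (K : finType) (J : Om -> K) k : 0 <= pmass J k.
Proof. exact/fine_ge0/measure_ge0. Qed.

Lemma measurable_preimage_fin (K : finType) (J : Om -> K) (A : set K) :
  (forall k, measurable (J @^-1` [set k])) -> measurable (J @^-1` A).
Proof.
move=> mJ; rewrite (_ : J @^-1` A = \bigcup_(k in A) J @^-1` [set k]).
  exact: fin_bigcup_measurable.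
by apply/seteqP; split=> [t At|t [k Ak /= ->]]//; exists (J t).
Qed.

(** [f (J t)] is pointwise the sum over [k] of [f k] times the indicator of the fibre over [k]; all
    expectations below reduce to such finite sums. *)
Lemma expectation_fin (K : finType) (J : Om -> K) (f : K -> R) :
  (forall k, measurable (J @^-1` [set k])) ->
  ('E_P[fun t => f (J t)] = (\sum_k f k * pmass J k)%:E)%E.
Proof.
move=> mJ; rewrite unlock.
have intJ k : P.-integrable [set: Om] (fun t => (\1_(J @^-1` [set k]) t)%:E).
  exact: integrable_indic.
transitivity (\int[P]_t \sum_k ((f k)%:E * (\1_(J @^-1` [set k]) t)%:E))%E.
  apply: eq_integral => t _; rewrite (bigD1 (J t))//= big1 ?adde0.
    by rewrite indicE mem_set ?mule1.
  move=> k /eqP kJ; rewrite indicE memNset ?mule0//= => Jk.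
  by apply: kJ; rewrite Jk.
rewrite integral_sum//; last by move=> k; exact: integrableZl.
rewrite -sumEFin; apply: eq_bigr => k _.
rewrite integralZl// integral_indic// setIT EFinM; congr (_ * _)%E.
by rewrite /pmass fineK// fin_num_measure.
Qed.

Lemma sum_pmass (K : finType) (J : Om -> K) :
  (forall k, measurable (J @^-1` [set k])) -> \sum_k pmass J k = 1.
Proof.
move=> mJ; apply: EFin_inj; rewrite -(expectation_cst P 1).
rewrite (expectation_fin (fun=> 1) mJ); congr EFin.
by apply: eq_bigr => k _; rewrite mul1r.
Qed.

(** Double counting: the [n.+1] inclusion probabilities are equal, and they add up to the expected
    size of [J], which is [k]. *)
Lemma inclusion_probability (n k : nat) (J : Om -> {set 'I_n.+1}) i :
  uniform_random_subset P k J ->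
  \sum_(S : {set 'I_n.+1} | i \in S) pmass J S = k%:R / n.+1%:R.
Proof.
move=> [mJ cardJ unifJ].
pose incl j := \sum_(S : {set 'I_n.+1} | j \in S) pmass J S.
have inclE j : P [set t | j \in J t] = (incl j)%:E.
  rewrite -expectation_indic; last first.
    exact: measurable_preimage_fin (fun S : {set 'I_n.+1} => j \in S) mJ.
  rewrite (_ : \1__ = fun t => (j \in J t)%:R); last first.
    apply/funext => t; rewrite indicE.
    by case: (boolP (j \in J t)) => [jJ|/negP jJ]; [rewrite mem_set|rewrite memNset].
  rewrite (expectation_fin (fun S : {set 'I_n.+1} => (j \in S)%:R) mJ) /incl.
  rewrite [in RHS]big_mkcond; congr EFin; apply: eq_bigr => S _.
  by case: ifP; rewrite ?(mul1r, mul0r).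
have incl_cst j : incl j = incl i.
  by apply: EFin_inj; rewrite -!inclE; exact: unifJ.
have : \sum_j incl j = k%:R.
  apply: EFin_inj; rewrite -[in RHS](expectation_cst P).
  rewrite (_ : cst _ = fun t => #|J t|%:R); last first.
    by apply/funext => t; rewrite cardJ.
  rewrite (expectation_fin (fun S : {set 'I_n.+1} => #|S|%:R) mJ); congr EFin.
  rewrite /incl (exchange_big_dep predT)//=; apply: eq_bigr => S _.
  by rewrite sumr_const mulr_natl.
under eq_bigr do rewrite incl_cst.
rewrite sumr_const card_ord => <-.
by rewrite -[incl i *+ _]mulr_natr mulfK// pnatr_eq0.
Qed.

End FiniteRange.

(** * Algebra of symmetric forms and affine combinations *)

Lemma symC (R : realType) (U : lmodType R) (f : {symmetric U}) x y :
  f x y = f y x.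
Proof. by rewrite hermC expr0 mul1r. Qed.

Lemma sym_combr (R : realType) (U : lmodType R) (f : {symmetric U}) (c d : R)
    x y z :
  f z (c *: x + d *: y) = c * f z x + d * f z y.
Proof. by rewrite linearDr !linearZr_LR. Qed.

Lemma sym_quad (R : realType) (U : lmodType R) (f : {symmetric U}) (c d : R)
    x y :
  f (c *: x + d *: y) (c *: x + d *: y) =
  c ^+ 2 * f x x + 2 * c * d * f x y + d ^+ 2 * f y y.
Proof.
rewrite sym_combr !(symC f (_ + _)) !sym_combr (symC f y x); ring.
Qed.

Lemma sub_affine (R : pzRingType) (U : lmodType R) (t : R) (u x y : U) :
  u - (t *: x + (1 - t) *: y) = t *: (u - x) + (1 - t) *: (u - y).
Proof.
by rewrite !scalerBr addrACA -scalerDl [t + _]addrC subrK scale1r -opprD.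
Qed.

(** * The splitting norm as an infimum of costs *)

Section SpaceSplitting.
Context (R : realType) (V : lmodType R) (a : {symmetric V}).
Context (n : nat) (V_ : 'I_n.+1 -> lmodType R).
Context (a_ : forall i, {dot (V_ i) for idfun}).
Context (R_ : forall i, {linear V_ i -> V}).
Context (T_ : forall i, {linear V -> V_ i}) (w : 'I_n.+1 -> R).
Context (w_gt0 : forall i, 0 < w i).
Context (T_def : forall i v (x : V_ i), a_ i (T_ i v) x = a v (R_ i x)).
Context (R_sum : forall v, exists v_ : forall i, V_ i,
  v = \sum_(i < n.+1) R_ i (v_ i)).

Let q := split_norm2 a_ R_ w.
Let G := subset_correction R_ T_ w.
Let synth (v_ : forall i, V_ i) := \sum_(i < n.+1) w i *: R_ i (v_ i).
Let cost (v_ : forall i, V_ i) := \sum_(i < n.+1) w i * a_ i (v_ i) (v_ i).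

Lemma dot_ge0 i (x : V_ i) : 0 <= a_ i x x.
Proof.
by have [->|x0] := eqVneq x 0; [rewrite linear0l | rewrite ltW// neq0_dnorm_gt0].
Qed.

(** The gap between the two sides is [b * (1 - b)] times the square of [x - y]. *)
Lemma dot_convex i b (x y : V_ i) : 0 <= b -> b <= 1 ->
  a_ i (b *: x + (1 - b) *: y) (b *: x + (1 - b) *: y) <=
  b * a_ i x x + (1 - b) * a_ i y y.
Proof.
rewrite -subr_ge0 => b0; rewrite -subr_ge0 => b1.
have := mulr_ge0 (mulr_ge0 b0 b1) (dot_ge0 (1 *: x + (-1) *: y)).
by rewrite !sym_quad; lra.
Qed.

Lemma cost_ge0 v_ : 0 <= cost v_.
Proof. by apply: sumr_ge0 => i _; rewrite mulr_ge0 ?dot_ge0// ltW. Qed.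

Let costs v := [set s : R | exists v_, v = synth v_ /\ s = cost v_].

(** Rescaling a decomposition from [R_sum] by the inverse weights gives a competitor, so [inf] never
    takes its default value. *)
Lemma has_inf_costs v : has_inf (costs v).
Proof.
split; last by exists 0 => _ [y_ [_ ->]]; exact: cost_ge0.
have [v_ ->] := R_sum v; exists (cost (fun i => (w i)^-1 *: v_ i)).
exists (fun i => (w i)^-1 *: v_ i); split=> //.
by apply: eq_bigr => i _; rewrite linearZ scalerA divff ?scale1r ?gt_eqF.
Qed.

Lemma split_norm2_le v_ : q (synth v_) <= cost v_.
Proof. by apply: ge_inf; [exact: (has_inf_costs _).2 | exists v_]. Qed.

Lemma split_norm2_ge0 v : 0 <= q v.
Proof.
apply: lb_le_inf; first exact: (has_inf_costs v).1.
by move=> _ [y_ [_ ->]]; exact: cost_ge0.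
Qed.

Lemma split_norm2_adherent v e : 0 < e ->
  exists2 v_, v = synth v_ & cost v_ < q v + e.
Proof.
by move=> /inf_adherent/(_ (has_inf_costs v))[_ [v_ [vE ->]] lt_e]; exists v_.
Qed.

(** Near-optimal decompositions of [x] and [y] are combined componentwise; their slacks combine to
    [b * e + (1 - b) * e = e]. *)
Lemma split_norm2_convex b x y : 0 <= b -> b <= 1 ->
  q (b *: x + (1 - b) *: y) <= b * q x + (1 - b) * q y.
Proof.
move=> b0 b1; apply/ler_addgt0Pr => e e0.
have [x_ -> xle] := split_norm2_adherent x e0.
have [y_ -> yle] := split_norm2_adherent y e0.
pose z_ i := b *: x_ i + (1 - b) *: y_ i.
have -> : b *: synth x_ + (1 - b) *: synth y_ = synth z_.
  rewrite !scaler_sumr -big_split; apply: eq_bigr => i _ /=.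
  by rewrite (linearD (R_ i)) !(linearZ_LR (R_ i)) scalerDr !scalerA
    (mulrC (w i) b) (mulrC (w i) (1 - b)).
apply: (le_trans (split_norm2_le z_)).
apply: (@le_trans _ _ (b * cost x_ + (1 - b) * cost y_)); last by nra.
rewrite !mulr_sumr -big_split; apply: ler_sum => i _ /=.
rewrite mulrCA [(1 - b) * _]mulrCA -mulrDr ler_pM2l//.
exact: dot_convex.
Qed.

(** * Effect of a subset correction on both norms *)

Let local_energy (S : {set 'I_n.+1}) e :=
  \sum_(i in S) w i * a_ i (T_ i e) (T_ i e).

Lemma a_correction S e : a e (G S e) = local_energy S e.
Proof.
rewrite linear_sumr; apply: eq_bigr => i _.
by rewrite linearZr_LR T_def.
Qed.

(** Shifting the components [i] in [S] by [c *: T_ i e] decomposes the corrected vector; the bound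
    is the expanded cost of this competitor. *)
Lemma split_norm2_correction v_ c S e :
  q (synth v_ + c *: G S e) <=
  cost v_ + 2 * c * (\sum_(i in S) w i * a_ i (T_ i e) (v_ i))
  + c ^+ 2 * local_energy S e.
Proof.
pose z_ i := 1 *: v_ i + (if i \in S then c else 0) *: T_ i e.
have -> : synth v_ + c *: G S e = synth z_.
  rewrite /G /subset_correction scaler_sumr [X in _ + X]big_mkcond -big_split.
  apply: eq_bigr => i _ /=; rewrite (linearD (R_ i)) !(linearZ_LR (R_ i)) scale1r.
  by case: ifP => _; rewrite scalerDr !scalerA ?(mulrC (w i) c)// mulr0 scale0r.
apply: (le_trans (split_norm2_le z_)).
rewrite [X in 2 * c * X]big_mkcond [X in c ^+ 2 * X]big_mkcond.
rewrite !mulr_sumr -!big_split; apply: ler_sum => i _ /=.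
rewrite sym_quad (symC _ (v_ i)); case: ifP => _; lra.
Qed.

Lemma split_norm2_correction0 S e : q (G S e) <= local_energy S e.
Proof.
have := split_norm2_correction (fun=> 0) 1 S e.
have -> : synth (fun=> 0) = 0 by apply: big1 => i _; rewrite linear0 scaler0.
have -> : cost (fun=> 0) = 0 by apply: big1 => i _; rewrite linear0r mulr0.
rewrite [X in _ * X]big1 => [|i _]; last by rewrite linear0r mulr0.
by rewrite add0r scale1r; lra.
Qed.

Context (lbar llow : R) (llow_gt0 : 0 < llow) (lbar_gt0 : 0 < lbar).
Context (llow_bound : forall v, llow * q v <= a v v).
Context (lbar_bound : forall v, a v v <= lbar * q v).

(** The linear term is [- 2 * lbar^-1] times the local energy, and [lbar_bound] caps the quadratic
    term at [lbar^-1] times it. *)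
Lemma primal_step S e :
  a (e - lbar^-1 *: G S e) (e - lbar^-1 *: G S e) <=
  a e e - lbar^-1 * local_energy S e.
Proof.
rewrite -{1 3}[e]scale1r -scaleNr sym_quad a_correction.
have := le_trans (lbar_bound (G S e))
  (ler_wpM2l (ltW lbar_gt0) (split_norm2_correction0 S e)).
have lbar2_gt0 : 0 < lbar^-1 ^+ 2 by rewrite exprn_gt0// invr_gt0.
rewrite -(ler_pM2l lbar2_gt0) mulrA.
have -> : lbar^-1 ^+ 2 * lbar = lbar^-1 by field; rewrite gt_eqF.
by rewrite sqrrN; lra.
Qed.

(** * Averaging one step over the random index set *)

Context (mu : {set 'I_n.+1} -> R) (theta : R).
Context (mu_ge0 : forall S, 0 <= mu S) (mu_sum : \sum_S mu S = 1).
Context (mu_incl : forall i, \sum_(S : {set 'I_n.+1} | i \in S) mu S = theta).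

Lemma mean_sum_in (f : 'I_n.+1 -> R) :
  \sum_(S : {set 'I_n.+1}) (\sum_(i in S) f i) * mu S = theta * \sum_i f i.
Proof.
under eq_bigr do rewrite mulr_suml.
rewrite (exchange_big_dep predT)//= mulr_sumr; apply: eq_bigr => i _.
by rewrite -mulr_sumr mu_incl mulrC.
Qed.

Context (alpha beta eta : R).
Context (alpha_gt0 : 0 < alpha) (beta_ge0 : 0 <= beta) (beta_le1 : beta <= 1).
Context (etaE : llow * lbar * eta ^+ 2 = 1).
Context (betaE : 1 - beta = llow * eta * theta).
Context (alphaE : (1 - alpha) / alpha * theta = lbar * eta).

(* With [eta] balanced so that [llow * eta ^+ 2 = lbar^-1], the energy released
   by the primal step cancels the quadratic term of the dual step, for each set
   separately; only the cross term, linear in the correction, is averaged. *)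
Lemma mean_step_le e b :
  \sum_S (a (e - lbar^-1 *: G S e) (e - lbar^-1 *: G S e)
          + llow * q (b - eta *: G S e)) * mu S <=
  a e e + llow * q b - 2 * (1 - beta) * a e b.
Proof.
have llow_eta : llow * eta ^+ 2 = lbar^-1.
  by apply: (mulfI (lt0r_neq0 lbar_gt0)); rewrite mulfV ?gt_eqF// -etaE; ring.
apply/ler_addgt0Pr => eps eps0.
(* One decomposition of [b] serves all [S], so the cross term can be averaged; the slack
   [eps / llow] becomes [eps] after scaling by [llow]. *)
have [b_ bE b_le] := split_norm2_adherent b (divr_gt0 eps0 llow_gt0).
pose cross (S : {set 'I_n.+1}) := \sum_(i in S) w i * a_ i (T_ i e) (b_ i).
have term_le S : a (e - lbar^-1 *: G S e) (e - lbar^-1 *: G S e)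
    + llow * q (b - eta *: G S e) <=
    a e e + llow * q b + eps - 2 * llow * eta * cross S.
  have := split_norm2_correction b_ (- eta) S e; rewrite scaleNr -bE sqrrN.
  rewrite -(ler_pM2l llow_gt0) => dual.
  have := primal_step S e; rewrite -llow_eta => primal.
  move: b_le; rewrite -(ltr_pM2l llow_gt0) mulrDr (mulrCA _ eps) divff ?gt_eqF// mulr1.
  by rewrite /cross; lra.
apply: (@le_trans _ _
    (\sum_S (a e e + llow * q b + eps - 2 * llow * eta * cross S) * mu S)).
  by apply: ler_sum => S _; exact: ler_wpM2r.
under eq_bigr => S _ do rewrite mulrBl -[_ * cross S * _]mulrA.
rewrite sumrB -!mulr_sumr mu_sum /cross mean_sum_in.
have -> : \sum_i w i * a_ i (T_ i e) (b_ i) = a e b.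
  by rewrite bE linear_sumr; apply: eq_bigr => i _; rewrite T_def linearZr_LR.
by rewrite betaE; lra.
Qed.

(** The dual error before correction is a convex combination [b] of [ev] and [e]; once [a e b] is
    expressed through [eu], what remains is [- beta] times the square of [eu - e]. *)
Lemma step_contraction u (x : V * V) :
  \sum_S (a (u - (accel_step G u alpha beta lbar^-1 eta S x).1)
            (u - (accel_step G u alpha beta lbar^-1 eta S x).1)
     + llow * q (u - (accel_step G u alpha beta lbar^-1 eta S x).2)) * mu S
  <= beta * (a (u - x.1) (u - x.1) + llow * q (u - x.2)).
Proof.
rewrite /accel_step /=; set y := alpha *: x.2 + _.
set e := u - y; set eu := u - x.1; set ev := u - x.2.
pose c := (1 - alpha) / alpha.
(* This is [e = alpha *: ev + (1 - alpha) *: eu] solved for [ev]. *)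
have evE : ev = (1 + c) *: e + (- c) *: eu.
  apply: (scalerI (lt0r_neq0 alpha_gt0)); rewrite [RHS]scalerDr !scalerA.
  have -> : alpha * (1 + c) = 1 by rewrite /c; field; rewrite gt_eqF.
  have -> : alpha * - c = - (1 - alpha) by rewrite /c; field; rewrite gt_eqF.
  by rewrite scale1r scaleNr /e /y sub_affine addrK.
set b := beta *: ev + (1 - beta) *: e.
under eq_bigr => S _.
  rewrite -/e (opprD y) (opprD (_ + _) (eta *: _)) !addrA -/e sub_affine; over.
rewrite -/b.
apply: (le_trans (mean_step_le e b)).
have := split_norm2_convex ev e beta_ge0 beta_le1; rewrite -/b.
rewrite -(ler_pM2l llow_gt0) => q_b.
have beta1 : 0 <= 1 - beta by rewrite subr_ge0.
have := ler_wpM2l beta1 (llow_bound e).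
have a_ge0 : 0 <= beta * a (1 *: eu + (-1) *: e) (1 *: eu + (-1) *: e).
  by rewrite mulr_ge0// (le_trans _ (llow_bound _))// mulr_ge0 ?split_norm2_ge0// ltW.
(* The choice of [alpha] serves this identity, which turns [(1 - beta) * a e b] into
   [a e e - beta * a e eu]. *)
have c_beta : (1 - beta) * c = 1.
  transitivity (llow * eta * (c * theta)); first by rewrite betaE; ring.
  by rewrite alphaE -[RHS]etaE; ring.
have : (1 - beta) * a e b = a e e - beta * a e eu.
  rewrite /b sym_combr evE sym_combr.
  transitivity ((1 - beta) ^+ 2 * a e e + (1 - beta) * beta * a e e
    + (1 - beta) * c * beta * (a e e - a e eu)); first by ring.
  by rewrite c_beta; ring.
move: a_ge0; rewrite sym_quad (symC a eu); lra.
Qed.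

End SpaceSplitting.

(** * Independence of the next index set from the past *)

Section History.
Context (d : measure_display) (Om : measurableType d) (R : realType).
Context (P : probability Om R) (K : finType) (J : nat -> Om -> K).
Context (mJ : forall m k, measurable (J m @^-1` [set k])).

Definition history m t : {ffun 'I_m -> K} := [ffun i : 'I_m => J i t].

(** Indexed by all naturals, as the events of [mutually_independent] are; for [j >= m] the condition
    is void and the set is all of [K]. *)
Let extends m (h : {ffun 'I_m -> K}) j : set K :=
  [set k | forall i : 'I_m, i = j :> nat -> h i = k].

Lemma preimage_history m h :
  history m @^-1` [set h] = \bigcap_(j in [set` iota 0 m]) (J j @^-1` extends h j).
Proof.
apply/seteqP; split=> [t /= <- j _ i <-|t Jh]; first by rewrite ffunE.
apply/ffunP => i; rewrite ffunE; apply/esym/(Jh i) => //=.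
by rewrite mem_iota add0n ltn_ord.
Qed.

Lemma measurable_history m h : measurable (history m @^-1` [set h]).
Proof.
by rewrite preimage_history; apply: bigcap_measurableType => j _;
  exact: measurable_preimage_fin.
Qed.

(** A single family [B] describes the history over [iota 0 m] and the joint event over
    [iota 0 m.+1]; independence factors both, and they differ by the last factor. *)
Lemma pmass_history_next m h k : mutually_independent P J ->
  pmass P (fun t => (history m t, J m t)) (h, k) =
  pmass P (history m) h * pmass P (J m) k.
Proof.
move=> indepJ; pose B j := if j == m then [set k] else extends h j.
have PB s : uniq s -> fine (P (\bigcap_(j in [set` s]) (J j @^-1` B j))) =
    \prod_(j <- s) fine (P (J j @^-1` B j)).
  by move=> us; rewrite indepJ.
have histB : history m @^-1` [set h] =
    \bigcap_(j in [set` iota 0 m]) (J j @^-1` B j).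
  rewrite preimage_history; apply: eq_bigcapr => j /=.
  by rewrite mem_iota add0n /B => jm; rewrite ltn_eqF.
have jointB : (fun t => (history m t, J m t)) @^-1` [set (h, k)] =
    \bigcap_(j in [set` iota 0 m.+1]) (J j @^-1` B j).
  rewrite -addn1 iotaD add0n.
  rewrite bigcap_seq big_cat big_seq1 -bigcap_seq -histB /B eqxx.
  by apply/seteqP; split=> t /= [-> ->].
rewrite /pmass jointB histB !PB ?iota_uniq// -addn1 iotaD add0n big_cat big_seq1.
by rewrite {2}/B eqxx.
Qed.

Lemma expectation_history m (f : {ffun 'I_m -> K} -> R) :
  ('E_P[fun t => f (history m t)] =
   (\sum_h f h * pmass P (history m) h)%:E)%E.
Proof. exact/expectation_fin/measurable_history. Qed.

(** The inner sum is the conditional expectation given the history [h]. *)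
Lemma expectation_history_next m (f : {ffun 'I_m -> K} -> K -> R) :
  mutually_independent P J ->
  ('E_P[fun t => f (history m t) (J m t)] =
   (\sum_h (\sum_k f h k * pmass P (J m) k) * pmass P (history m) h)%:E)%E.
Proof.
move=> indepJ.
rewrite (expectation_fin P (J := fun t => (history m t, J m t)) (fun x => f x.1 x.2)).
  congr EFin; transitivity (\sum_h \sum_k f h k *
      pmass P (fun t => (history m t, J m t)) (h, k)).
    by rewrite pair_bigA; apply: eq_bigr => -[h k].
  apply: eq_bigr => h _; rewrite mulr_suml; apply: eq_bigr => k _.
  by rewrite pmass_history_next// -mulrA [pmass _ (J m) _ * _]mulrC.
move=> [h k]; rewrite (_ : _ @^-1` _ =
  history m @^-1` [set h] `&` J m @^-1` [set k]).
  by apply: measurableI => //; exact: measurable_history.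
by apply/seteqP; split=> t /= [-> ->].
Qed.

End History.

(** * The iterates as functions of past index sets, and their convergence *)

Lemma accel_iter_eq (R : realType) (n : nat) (V : lmodType R)
    (G : {set 'I_n.+1} -> V -> V) u (alpha beta xi eta : nat -> R) S S' m :
  (forall k, (k < m)%N -> S k = S' k) ->
  accel_iter G u alpha beta xi eta S m = accel_iter G u alpha beta xi eta S' m.
Proof.
elim: m => //= m IH SS'; rewrite SS'// IH// => k km.
by rewrite SS'// ltnS ltnW.
Qed.

Theorem theorem2 (R : realType)
  (* the variational problem *)
  (V : completeNormedModType R) (hV : separable_hilbert V)
  (a : {symmetric V})
  (a_cont : continuous (fun x : V * V => a x.1 x.2))
  (a_coer : coercive a)
  (F : {scalar V}) (F_bnd : bounded_functional F)
  (u : V) (hu : forall v, a u v = F v)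
  (* the space splitting *)
  (n : nat)
  (V_ : 'I_n.+1 -> completeNormedModType R)
  (hV_ : forall i, separable_hilbert (V_ i))
  (a_ : forall i, {dot (V_ i) for idfun})
  (a_equiv : forall i, spectrally_equivalent (a_ i))
  (R_ : forall i, {linear V_ i -> V})
  (R_bnd : forall i, bounded_op (R_ i))
  (R_ker : forall i (x : V_ i), R_ i x = 0 -> x = 0)
  (R_sum : forall v : V, exists v_ : forall i, V_ i,
     v = \sum_(i < n.+1) R_ i (v_ i))
  (T_ : forall i, {linear V -> V_ i})
  (T_bnd : forall i, bounded_op (T_ i))
  (T_def : forall i (v : V) (x : V_ i), a_ i (T_ i v) x = a v (R_ i x))
  (* weights and spectral bounds *)
  (w : 'I_n.+1 -> R) (w_gt0 : forall i, 0 < w i)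
  (lmin lmax : R) (lmin_gt0 : 0 < lmin) (lmin_le_lmax : lmin <= lmax)
  (lmin_bound : forall v : V, lmin * split_norm2 a_ R_ w v <= a v v)
  (lmax_bound : forall v : V, a v v <= lmax * split_norm2 a_ R_ w v)
  (llow lbar : R) (llow_gt0 : 0 < llow) (llow_le : llow <= lmin)
  (lbar_ge : lmax <= lbar)
  (kappa : R) (kappaE : kappa = lbar / llow)
  (* parameters of the iteration *)
  (p : nat -> nat) (p_bounds : forall m, (1 <= p m <= n.+1)%N)
  (xi eta alpha beta : nat -> R)
  (xiE : forall m, xi m = lbar^-1)
  (etaE : forall m, eta m = (Num.sqrt (lbar * llow))^-1)
  (alpha01 : forall m, 0 < alpha m < 1)
  (alphaE : forall m,
     (1 - alpha m) / alpha m = n.+1%:R * lbar / (p m)%:R * eta m)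
  (betaE : forall m, beta m = 1 - (p m)%:R / (n.+1%:R * Num.sqrt kappa))
  (* the random index sets *)
  (d : measure_display) (Om : measurableType d) (P : probability Om R)
  (I : nat -> Om -> {set 'I_n.+1})
  (assumptionA : forall m, uniform_random_subset P (p m) (I m)) :
  let G := subset_correction R_ T_ w in
  let step m := accel_step G u (alpha m) (beta m) (xi m) (eta m) in
  let um m t := (accel_iter G u alpha beta xi eta (I ^~ t) m).1 in
  let rho m := 1 - (p m)%:R / (n.+1%:R * Num.sqrt kappa) in
  (forall (m : nat) (x : V * V),
     ('E_P[fun t => (energy_norm a (u - (step m (I m t) x).1) ^+ 2
                    + llow * split_norm2 a_ R_ w (u - (step m (I m t) x).2))%R]
      <= (rho m * (energy_norm a (u - x.1) ^+ 2
                   + llow * split_norm2 a_ R_ w (u - x.2)))%:E)%E)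
  /\
  (mutually_independent P I ->
     (('E_P[fun t => (energy_norm a (u - um m t) ^+ 2)%R])%E
        @[m --> \oo] --> 0%E) /\
     (forall m : nat, (1 <= m)%N ->
        ('E_P[fun t => (energy_norm a (u - um m t) ^+ 2)%R]
         <= (2 * (\prod_(0 <= s < m) rho s) * energy_norm a u ^+ 2)%:E)%E)).
Proof.
move=> G step um rho.
set q := split_norm2 _ _ w.
have lbar_gt0 : 0 < lbar.
  by apply: lt_le_trans lbar_ge; exact: lt_le_trans lmin_le_lmax.
have q_ge0 v : 0 <= q v by exact: split_norm2_ge0.
have llow_bound v : llow * q v <= a v v.
  by apply: le_trans (lmin_bound v); exact: ler_wpM2r.
have lbar_bound v : a v v <= lbar * q v.
  by apply: (le_trans (lmax_bound v)); exact: ler_wpM2r.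
have a_ge0 v : 0 <= a v v.
  by apply: le_trans (llow_bound v); rewrite mulr_ge0// ltW.
have energyE v : energy_norm a v ^+ 2 = a v v by exact: sqr_sqrtr.
pose g (x : V * V) := a (u - x.1) (u - x.1) + llow * q (u - x.2).
(* The contraction gain for [p m = 1], the smallest size; [1 - r] thus bounds every [rho m]. *)
pose r := (n.+1%:R * Num.sqrt kappa)^-1.
have kappa_ge1 : 1 <= Num.sqrt kappa.
  rewrite -[leLHS]sqrtr1 ler_wsqrtr// kappaE ler_pdivlMr// mul1r.
  exact: le_trans llow_le (le_trans lmin_le_lmax lbar_ge).
have n1_gt0 : 0 < n.+1%:R :> R by rewrite ltr0n.
have kappa_gt0 : 0 < Num.sqrt kappa by exact: lt_le_trans kappa_ge1.
have r_gt0 : 0 < r by rewrite invr_gt0 mulr_gt0.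
have rho_ge0 m : 0 <= rho m.
  rewrite /rho subr_ge0 ler_pdivrMr ?mulr_gt0// mul1r.
  have /andP[_ pn] := p_bounds m.
  by rewrite -[leLHS]mulr1 ler_pM// ler_nat.
have rho_le m : rho m <= 1 - r.
  rewrite lerD2l lerN2 -[leLHS]mul1r ler_pM2r// ler1n.
  by case/andP: (p_bounds m).
(* That is, [llow * eta m] is the inverse of [Num.sqrt kappa], which links [beta m] to [eta m]. *)
have sqrt_kappa : llow * (Num.sqrt (lbar * llow))^-1 = (Num.sqrt kappa)^-1.
  rewrite kappaE sqrtrM ?ltW// [in RHS]sqrtrM ?ltW// sqrtrV ?ltW// invfM invfM invrK.
  rewrite -{1}(sqr_sqrtr (ltW llow_gt0)) expr2 [X in _ * X]mulrC mulrA mulfK//.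
    by rewrite mulrC.
  by rewrite gt_eqF// sqrtr_gt0.
have step_le m x :
    \sum_S g (step m S x) * pmass P (I m) S <= rho m * g x.
  have [mI _ _] := assumptionA m.
  rewrite /step xiE /rho -betaE.
  have p_gt0 : 0 < (p m)%:R :> R by rewrite ltr0n; case/andP: (p_bounds m).
  (* Here [mu] is the law of [I m] and [theta] is [p m / n.+1]. *)
  apply: (step_contraction w_gt0 T_def R_sum llow_gt0 lbar_gt0 llow_bound lbar_bound
    (pmass_ge0 P (I m)) (sum_pmass P mI)
    (fun i => inclusion_probability i (assumptionA m))).
  - by case/andP: (alpha01 m).
  - by rewrite betaE; exact: rho_ge0.
  - rewrite betaE gerBl divr_ge0// ltW// mulr_gt0//.
  - rewrite etaE exprVn sqr_sqrtr ?mulr_ge0 ?ltW//.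
    by rewrite [llow * _]mulrC mulfV// gt_eqF// mulr_gt0.
  - rewrite betaE etaE sqrt_kappa; field.
    by rewrite !gt_eqF.
  - rewrite alphaE; field.
    by rewrite !gt_eqF.
split=> [m x|indepI].
  under eq_fun do rewrite energyE.
  have [mI _ _] := assumptionA m.
  rewrite (expectation_fin P (fun S => g (step m S x)) mI) lee_fin energyE.
  exact: step_le.
have mI m S : measurable (I m @^-1` [set S]) by have [] := assumptionA m.
(* The iterate at time [m] is a function of the first [m] index sets, a random
   variable with finite range that is independent of [I m]; the default
   [set0] is never read. *)
pose state m (h : {ffun 'I_m -> {set 'I_n.+1}}) :=
  accel_iter G u alpha beta xi eta (fun j => oapp h finset.set0 (insub j)) m.
have stateE m t : accel_iter G u alpha beta xi eta (I ^~ t) m = state m (history I m t).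
  apply: accel_iter_eq => k km; rewrite insubT/= ffunE.
  by [].
pose Eg m := \sum_h g (state m h) * pmass P (history I m) h.
have Eg_next m : Eg m.+1 <= rho m * Eg m.
  have -> : Eg m.+1 = \sum_h (\sum_S g (step m S (state m h)) * pmass P (I m) S)
      * pmass P (history I m) h.
    apply: EFin_inj; rewrite -(expectation_history P mI (fun h => g (state m.+1 h))).
    rewrite -(expectation_history_next mI (fun h S => g (step m S (state m h))))//.
    by congr expectation; apply/funext => t; rewrite -!stateE.
  rewrite /Eg mulr_sumr; apply: ler_sum => h _.
  by rewrite mulrA ler_wpM2r ?pmass_ge0.
have Eg_le m : Eg m <= (\prod_(0 <= s < m) rho s) * (2 * energy_norm a u ^+ 2).
  elim: m => [|m IH].
    (* Both initial errors equal [u], and [llow * q u <= a u u]: hence the factor 2. *)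
    rewrite big_nil mul1r /Eg /state /= /g /= subr0 energyE -mulr_sumr.
    rewrite sum_pmass ?mulr1; last exact: measurable_history.
    by have := llow_bound u; lra.
  apply: (le_trans (Eg_next m)); rewrite big_nat_recr//= mulrAC mulrC.
  by rewrite ler_wpM2r// mulrC.
have E_le m : ('E_P[fun t => (energy_norm a (u - um m t) ^+ 2)%R]
    <= (2 * (\prod_(0 <= s < m) rho s) * energy_norm a u ^+ 2)%:E)%E.
  under eq_fun do rewrite energyE /um stateE.
  rewrite (expectation_history P mI (fun h => a (u - (state m h).1) (u - (state m h).1))).
  rewrite lee_fin [2 * _]mulrC -mulrA; apply: le_trans (Eg_le m).
  (* The dual part of [g] is nonnegative and is dropped. *)
  apply: ler_sum => h _; rewrite ler_wpM2r ?pmass_ge0// lerDl.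
  by rewrite mulr_ge0// ltW.
split=> [|m _]; last exact: E_le.
have prod_le m : \prod_(0 <= s < m) rho s <= (1 - r) ^+ m.
  elim: m => [|m IH]; first by rewrite big_nil.
  rewrite big_nat_recr//= exprSr ler_pM//.
  by rewrite big_mkord prodr_ge0.
have r1 : `|1 - r| < 1.
  rewrite ger0_norm; first by rewrite gtrBl.
  exact: le_trans (rho_ge0 0) (rho_le 0).
apply: (@squeeze_cvge _ _ _ _ (cst 0%E) _
  (fun m => (geometric (2 * energy_norm a u ^+ 2) (1 - r) m)%:E)).
- apply: nearW => m; rewrite expectation_ge0/=; last by move=> t; exact: sqr_ge0.
  apply: (le_trans (E_le m)); rewrite lee_fin mulrAC ler_wpM2l//.
  by rewrite mulr_ge0// sqr_ge0.
- exact: cvg_cst.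
- by apply: cvg_EFin; [exact: nearW|exact: cvg_geometric].
Qed.
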